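(* Let $p>1$, $\beta=1/(p-1)$ and $\gamma=\frac{p-2}{2(p-1)}$. There exists a positive ancient solution $u$ of the half-space problem $u_t-\Delta u=|\nabla u|^p$ in $\mathbb{R}^n_+\times(-\infty,0)$, $u=0$ on $\partial\mathbb{R}^n_+\times(-\infty,0)$, which is not stationary. Namely, $u$ can be taken of the form $$u(x,t)=|t|^\gamma\,\phi\Big(\frac{x_n}{\sqrt{|t|}}\Big),\qquad (x,t)\in\mathbb{R}^n_+\times(-\infty,0),$$ where $\phi\in C^2([0,\infty))$ satisfies $\phi(0)=0$, $\phi'>0$ on $[0,\infty)$ and $\lim_{y\to\infty}\phi(y)/y^{\beta+1}=L$ for some $L>0$.
   Context: $\mathbb{R}^n_+:=\{x\in\mathbb{R}^n: x_n>0\}$. An ancient solution of the half-space problem is a function $u\in C^{2,1}(Q)\cap C(\overline Q)$, $Q=\mathbb{R}^n_+\times(-\infty,0)$, satisfying the PDE pointwise in $Q$ and $u=0$ pointwise on $\partial\mathbb{R}^n_+\times(-\infty,0)$.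
   Formalization: Continuity of u up to the boundary is required on the closed half-space times (-∞,0), not on the full closure of Q, which contains t=0: there u of the stated form behaves like L x_n^{β+1}|t|^{-β} and blows up. *)

(* Defs.v *)
From HB Require Import structures.
From mathcomp Require Import all_boot all_order all_algebra.
From mathcomp Require Import all_classical all_reals all_analysis.
Set Implicit Arguments. Unset Strict Implicit. Unset Printing Implicit Defensive.
Import Order.TTheory GRing.Theory Num.Theory.
Import numFieldNormedType.Exports.
Local Open Scope classical_set_scope.
Local Open Scope ring_scope.

Section Defs.
Variable R : realType.
Variable n : nat.
(* Points of R^(n+1) are row vectors 'rV[R]_n.+1; the last coordinate
   x_{n+1} = x 0 ord_max plays the role of "x_n" in the paper. *)
Notation pt := 'rV[R]_n.+1.

Definition lastc (x : pt) : R := x 0 ord_max.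

Definition Qset : set (pt * R) := [set z | 0 < lastc z.1 /\ z.2 < 0].
Definition Qbar : set (pt * R) := [set z | 0 <= lastc z.1 /\ z.2 < 0].

Definition evec (i : 'I_n.+1) : pt := delta_mx 0 i.

Definition pdx (i : 'I_n.+1) (u : pt -> R -> R) (x : pt) (t : R) : R :=
  derive (fun y => u y t) x (evec i).
Definition pdxx (i j : 'I_n.+1) (u : pt -> R -> R) (x : pt) (t : R) : R :=
  derive (fun y => pdx j u y t) x (evec i).
Definition pdt (u : pt -> R -> R) (x : pt) (t : R) : R :=
  derive (fun s => u x s) t 1.

Definition C21_on_Q (u : pt -> R -> R) : Prop :=
  forall x t, Qset (x, t) ->
    (forall i, derivable (fun y => u y t) x (evec i)) /\
    (forall i j, derivable (fun y => pdx j u y t) x (evec i)) /\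
    derivable (fun s => u x s) t 1 /\
    {for (x, t), continuous (fun z : pt * R => u z.1 z.2)} /\
    (forall i, {for (x, t), continuous (fun z : pt * R => pdx i u z.1 z.2)}) /\
    (forall i j, {for (x, t), continuous (fun z : pt * R => pdxx i j u z.1 z.2)}) /\
    {for (x, t), continuous (fun z : pt * R => pdt u z.1 z.2)}.

Definition laplacian (u : pt -> R -> R) (x : pt) (t : R) : R :=
  \sum_(i < n.+1) pdxx i i u x t.

Definition gradnorm (u : pt -> R -> R) (x : pt) (t : R) : R :=
  Num.sqrt (\sum_(i < n.+1) (pdx i u x t) ^+ 2).

Definition ancient_solution (p : R) (u : pt -> R -> R) : Prop :=
  C21_on_Q u /\
  {within Qbar, continuous (fun z : pt * R => u z.1 z.2)} /\
  (forall x t, Qset (x, t) ->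
     pdt u x t - laplacian u x t = gradnorm u x t `^ p) /\
  (forall x t, lastc x = 0 -> t < 0 -> u x t = 0).

Definition stationary (u : pt -> R -> R) : Prop :=
  forall x t s, Qset (x, t) -> Qset (x, s) -> u x t = u x s.

End Defs.

Section Phi.
Variable R : realType.

Definition C2_halfline (phi phi1 phi2 : R -> R) : Prop :=
  (forall y : R, 0 < y -> is_derive y (1:R) phi (phi1 y)) /\
  (forall y : R, 0 < y -> is_derive y (1:R) phi1 (phi2 y)) /\
  (fun h => (phi h - phi 0) / h) @ 0^'+ --> phi1 0 /\
  (fun h => (phi1 h - phi1 0) / h) @ 0^'+ --> phi2 0 /\
  {within `[0, +oo[, continuous phi} /\
  {within `[0, +oo[, continuous phi1} /\
  {within `[0, +oo[, continuous phi2}.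

End Phi.

Definition selfsim (R : realType) (n : nat) (gamma : R) (phi : R -> R)
  : 'rV[R]_n.+1 -> R -> R :=
  fun x t => `|t| `^ gamma * phi (lastc x / Num.sqrt `|t|).

(* Main.v *)
Require Import Defs.
From HB Require Import structures.
From mathcomp Require Import all_boot all_order all_algebra.
From mathcomp Require Import all_classical all_reals all_analysis.
From mathcomp Require Import ring lra.
Import Order.TTheory GRing.Theory Num.Theory.
Import numFieldNormedType.Exports.
Local Open Scope classical_set_scope.
Local Open Scope ring_scope.

(* The profile is sought through the logarithmic slope r = phi'' / phi'.
   Differentiating the profile equation and setting w = phi', v = w^(p-1) and
   beta = 1/(p-1) gives the first-order system
     v' = r v / beta,   r' = beta/2 + (y/2 - p v) r - r^2,   r(0) = - v(0),
   where v(0) > 0 is free.  Since r' = beta/2 > 0 whenever r = 0, a small v(0)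
   makes r positive from y = 1 on; once r is clipped to [-1, 1 + beta + y],
   bounds that are never reached, the system is a Volterra equation for r with a
   global solution.  For the behaviour at infinity,
   N = v (r/beta + p v/2 - y/2) satisfies N' = (1 - beta) (r/beta)^2 v, without
   terms of order y.  First v >= k (y - A) with p k > 1/2, which makes the linear
   term of the r-equation damping, so r = O(1/y); then N = O(v), i.e.
   p v = y + O(1), and integrating w = v^beta gives
   phi ~ p^(-beta) y^(beta+1) / (beta+1). *)

(** * Derivatives and primitives on the half-line *)

Section ScalarDerivatives.
Context {R : realType}.
Implicit Types f g df dg : R -> R.

Lemma is_derive1_continuous {f} {x d : R} :
  is_derive x 1 f d -> {for x, continuous f}.
Proof.
by move=> [fx _]; exact/differentiable_continuous/derivable1_diffP.
Qed.

Lemma is_derive1D {f g} {x a b : R} : is_derive x 1 f a ->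
  is_derive x 1 g b -> is_derive x 1 (fun y => f y + g y) (a + b).
Proof. by move=> hf hg; exact: is_deriveD. Qed.

Lemma is_derive1N {f} {x a : R} : is_derive x 1 f a ->
  is_derive x 1 (fun y => - f y) (- a).
Proof. by move=> hf; exact: is_deriveN. Qed.

Lemma is_derive1B {f g} {x a b : R} : is_derive x 1 f a ->
  is_derive x 1 g b -> is_derive x 1 (fun y => f y - g y) (a - b).
Proof. by move=> hf hg; exact: is_deriveB. Qed.

Lemma is_derive1M {f g} {x a b : R} : is_derive x 1 f a ->
  is_derive x 1 g b -> is_derive x 1 (fun y => f y * g y) (a * g x + f x * b).
Proof.
move=> hf hg; apply: (is_derive_eq (is_deriveM hf hg)).
by rewrite /GRing.scale/=; ring.
Qed.

Lemma is_derive1Z {f} (c : R) {x a : R} : is_derive x 1 f a ->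
  is_derive x 1 (fun y => c * f y) (c * a).
Proof. by move=> hf; exact: is_deriveZ. Qed.

Lemma is_derive1_cst (c x : R) : is_derive x 1 (fun _ => c) 0.
Proof. exact: is_derive_cst. Qed.

Lemma is_derive1_id (x : R) : is_derive x 1 (fun y => y) 1.
Proof. exact: is_derive_id. Qed.

Lemma is_derive1_funcomp {f g} {x a b : R} : is_derive (g x) 1 f a ->
  is_derive x 1 g b -> is_derive x 1 (fun y => f (g y)) (a * b).
Proof. by move=> hf hg; exact: is_derive1_comp. Qed.

Lemma is_derive1_expRc {f} {x a : R} : is_derive x 1 f a ->
  is_derive x 1 (fun y => expR (f y)) (expR (f x) * a).
Proof. by move=> hf; exact: is_derive1_funcomp. Qed.

Lemma is_derive1_MVT f df (a b : R) : a <= b ->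
  (forall x, a <= x <= b -> is_derive x 1 f (df x)) ->
  exists2 c, a <= c <= b & f b - f a = df c * (b - a).
Proof.
move=> ab hf.
have [||c cab h] := @MVT_segment R f df a b ab.
- by move=> x /itvP xab; apply: hf; rewrite !xab.
- apply: derivable_within_continuous => x xab.
  by have [|//] := hf x; move: xab; rewrite in_itv.
- by exists c => //; move: cab; rewrite in_itv.
Qed.

Lemma is_derive1_ge0_le f df (a b : R) : a <= b ->
  (forall x, a <= x <= b -> is_derive x 1 f (df x)) ->
  (forall x, a <= x <= b -> 0 <= df x) -> f a <= f b.
Proof.
move=> ab hf h0; have [c cab h] := is_derive1_MVT f df a b ab hf.
by rewrite -subr_ge0 h mulr_ge0 ?subr_ge0//; exact: h0.
Qed.

Lemma is_derive1_0_eq f (a b : R) : a <= b ->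
  (forall x, a <= x <= b -> is_derive x 1 f 0) -> f a = f b.
Proof.
move=> ab hf; apply/eqP; rewrite eq_le; apply/andP; split.
  by apply: (@is_derive1_ge0_le f (fun=> 0)).
rewrite -lerN2; apply: (@is_derive1_ge0_le (fun x => - f x) (fun=> 0)) => //.
by move=> x /hf /is_derive1N; rewrite oppr0.
Qed.

(** First-zero argument: at the infimum [s] of the points where [f <= 0], continuity gives [f s = 0]
    and [a < s], while [0 < df s] would make [f] negative just to the left of [s]. The barriers
    below are instances, so that only points of contact have to be examined. *)
Lemma barrier_gt0 f df (a b : R) : a <= b ->
  (forall x, a <= x <= b -> is_derive x 1 f (df x)) -> 0 < f a ->
  (forall x, a < x <= b -> f x = 0 -> 0 < df x) -> 0 < f b.
Proof.
move=> ab hf fa0 hz; rewrite ltNge; apply/negP => fb0.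
pose Z := [set x | a <= x <= b /\ f x <= 0].
have Zb : Z b by split => //; rewrite ab lexx.
have hi : has_inf Z.
  by split; [exists b | exists a => x [/andP[]]].
have aZ : a <= inf Z by apply: lb_le_inf; [exists b|move=> x [/andP[]]].
have Zb' : inf Z <= b by apply: ge_inf => //; case: hi.
set s := inf Z in aZ Zb'.
have cs : {for s, continuous f} by apply: is_derive1_continuous; apply: hf; rewrite aZ.
have fs0 : f s <= 0.
  rewrite leNgt; apply/negP => fs.
  have [e /= e0 he] : exists2 e : R, 0 < e & forall x, `|s - x| < e -> 0 < f x.
    by have /nbhs_ballP[e e0 he] := cs _ (lt_nbhsr fs); exists e.
  have [x Zx xs] := @inf_adherent _ Z e e0 hi.
  have sx : s <= x by apply: ge_inf => //; case: hi.
  have : 0 < f x.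
    by apply: he; rewrite distrC ger0_norm ?subr_ge0// ltrBlDl.
  by move: Zx => [_]; rewrite leNgt => /negP.
have as' : a < s.
  by rewrite lt_neqAle aZ andbT; apply/eqP => ass; move: fs0; rewrite -ass leNgt fa0.
have pos x : a <= x -> x < s -> 0 < f x.
  move=> ax xs; rewrite ltNge; apply/negP => fx.
  have : s <= x.
    apply: ge_inf; first by case: hi.
    by split => //; rewrite ax (le_trans (ltW xs)).
  by rewrite leNgt xs.
have fs : f s = 0.
  apply/eqP; rewrite eq_le fs0/= leNgt; apply/negP => fs.
  have /nbhs_ballP[e /= e0 he] := cs _ (lt_nbhsl fs).
  (* The maximum with [a] keeps [x] where [pos] applies; [e / 2] keeps it in the neighbourhood of
     [s] on which [f] is negative. *)
  pose x := Num.max a (s - e / 2).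
  have xs : x < s by rewrite gt_max as' gtrBl divr_gt0.
  have : f x < 0.
    apply: (he x); rewrite /ball/= gtr0_norm ?subr_gt0//.
    rewrite ltrBlDr -ltrBlDl lt_max; apply/orP; right.
    by rewrite ltrD2l ltrN2 ltr_pdivrMr// mulr_natr mulr2n ltrDl.
  by rewrite ltNge ltW// pos// le_max lexx.
have dfs : 0 < df s by apply: hz => //; rewrite as'.
have hd : is_derive s 1 f (df s) by apply: hf; rewrite aZ.
(* Caratheodory slope: [f x - f s = g x * (x - s)] with [g] continuous at [s], so [g] stays positive
   slightly to the left and forces [f x < 0] there. *)
have /is_derive1_caratheodory[g [gE gc gs]] := hd.
rewrite -gs in dfs.
have /nbhs_ballP[e /= e0 he] := gc _ (lt_nbhsr dfs).
pose x := Num.max a (s - e / 2).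
have xs : x < s by rewrite gt_max as' gtrBl divr_gt0.
have gx : 0 < g x.
  apply: (he x); rewrite /ball/= gtr0_norm ?subr_gt0//.
  rewrite ltrBlDr -ltrBlDl lt_max; apply/orP; right.
  by rewrite ltrD2l ltrN2 ltr_pdivrMr// mulr_natr mulr2n ltrDl.
have : 0 < f x by rewrite pos// le_max lexx.
have := gE x; rewrite fs subr0 => ->.
by rewrite pmulr_rgt0// subr_gt0 ltNge ltW.
Qed.

(** Supplies the one-sided difference quotients at [0] that [C2_halfline] asks for. *)
Lemma is_derive1_cvg_at_right f (d : R) : is_derive (0 : R) 1 f d ->
  (f h - f 0) / h @[h --> 0^'+] --> d.
Proof.
move=> /is_derive1_caratheodory[g [fg cg <-]].
have : g h @[h --> 0^'+] --> g 0 by exact: cvg_at_right_filter.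
apply: cvg_trans; apply: near_eq_cvg; near=> h.
by rewrite fg subr0 mulfK// gt_eqF.
Unshelve. all: by end_near. Qed.

End ScalarDerivatives.

Section HalfLine.
Context {R : realType}.
Implicit Types f g : R -> R.

(** Continuity on the closed half-line, encoded as ordinary continuity of the extension by the
    constant [f 0]; values at negative arguments never enter. *)
Definition continuous0y f := continuous (fun y : R => f (Num.max 0 y)).

(* Extending [f] by the constant [f 0] on the left and integrating from [-1]
   makes the primitive two-sided differentiable at [0]. *)
Definition primitive0 f (y : R) : R :=
  (\int[lebesgue_measure]_(x in `[(-1)%R, y]) f (Num.max 0 x))%R
  - (\int[lebesgue_measure]_(x in `[(-1)%R, 0%R]) f (Num.max 0 x))%R.

Lemma primitive00 f : primitive0 f 0 = 0.
Proof. by rewrite /primitive0 subrr. Qed.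

Lemma is_derive_primitive0 {f} {y : R} : continuous0y f -> 0 <= y ->
  is_derive y 1 (primitive0 f) (f y).
Proof.
move=> cf y0; set g := fun x : R => f (Num.max 0 x).
(* The endpoints [-1] and [y + 1] make [y] an interior point, even for [y = 0]. *)
have [||||dF F'] := @continuous_FTC1_closed R g (-1) y (y + 1).
- by rewrite ltrDl.
- apply: continuous_compact_integrable; first exact: segment_compact.
  exact: continuous_subspaceT.
- by rewrite (lt_le_trans _ y0)// ltrN10.
- exact: cf.
have hF : is_derive y 1
    (fun z => \int[lebesgue_measure]_(x in `[(-1)%R, z]) g x)%R (f y).
  by split; [exact: dF|rewrite -derive1E F' /g max_r].
have := is_derive1B hF
  (is_derive1_cst (\int[lebesgue_measure]_(x in `[(-1)%R, 0%R]) g x)%R y).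
by rewrite subr0.
Qed.

Lemma continuous0y_for f : (forall y, 0 <= y -> {for y, continuous f}) ->
  continuous0y f.
Proof.
move=> cf y; apply: (@continuous_comp _ _ _ (fun y : R => Num.max 0 y) f).
  by apply: continuous_max; [exact: cvg_cst|exact: cvg_id].
by apply: cf; rewrite le_max lexx.
Qed.

Lemma primitive0_continuous f : continuous0y f -> continuous0y (primitive0 f).
Proof.
move=> cf; apply: continuous0y_for => y y0.
exact: (is_derive1_continuous (is_derive_primitive0 cf y0)).
Qed.

Lemma le_primitive0 f g (y : R) : continuous0y f -> continuous0y g -> 0 <= y ->
  (forall x, 0 <= x <= y -> f x <= g x) -> primitive0 f y <= primitive0 g y.
Proof.
move=> cf cg y0 fg; rewrite -subr_ge0.
have -> : 0 = primitive0 g 0 - primitive0 f 0 by rewrite !primitive00 subrr.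
apply: (@is_derive1_ge0_le R (fun x => primitive0 g x - primitive0 f x)
  (fun x => g x - f x)) => //.
  by move=> x /andP[x0 _]; apply: is_derive1B; exact: is_derive_primitive0.
by move=> x /fg; rewrite subr_ge0.
Qed.

Lemma primitive0_unique f F (y : R) : continuous0y f -> 0 <= y ->
  (forall x, 0 <= x <= y -> is_derive x 1 F (f x)) ->
  primitive0 f y = F y - F 0.
Proof.
move=> cf y0 hF.
have h : primitive0 f 0 - F 0 = primitive0 f y - F y.
  apply: (@is_derive1_0_eq R (fun x => primitive0 f x - F x)) => // x xy.
  rewrite -(subrr (f x)); apply: is_derive1B; last exact: hF.
  by apply: is_derive_primitive0 => //; case/andP: xy.
by rewrite primitive00 in h; lra.
Qed.

End HalfLine.

(** * Fixed points of Volterra operators *)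

Section FixedPoint.
Context {R : realType}.
Implicit Types f g : R -> R.

Lemma cvg_half_expr (c : R) : c * 2^-1 ^+ k @[k --> \oo] --> (0 : R).
Proof.
rewrite -[X in _ --> X](mulr0 c); apply: cvgMr.
by apply: cvg_expr; rewrite gtr0_norm ?invr_gt0// invf_lt1// ltr1n.
Qed.

Lemma half_expr_lt (c : R) {e : R} : 0 < e -> exists k, c * 2^-1 ^+ k < e.
Proof.
move=> e0; have [k _ hk] := cvgr_lt _ (cvg_half_expr c) e e0.
by exists k; apply: hk => /=.
Qed.

(** The remaining steps sum to at most [2 * C * 2^-1 ^+ k]. Adding this tail to [u k] gives a
    nonincreasing sequence, subtracting it a nondecreasing one, and both converge to the limit of
    [u]. *)
Lemma geometric_steps_dist_lim (u : nat -> R) (C : R) :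
  (forall k, `|u k.+1 - u k| <= C * 2^-1 ^+ k) ->
  forall k, `|u k - lim (u @ \oo)| <= 2 * C * 2^-1 ^+ k.
Proof.
move=> hu.
pose a k := u k + 2 * C * 2^-1 ^+ k.
pose b k := u k - 2 * C * 2^-1 ^+ k.
have C0 : 0 <= C by have := hu 0%N; rewrite expr0 mulr1; apply: le_trans.
have e0 k : 0 <= C * 2^-1 ^+ k by rewrite mulr_ge0// exprn_ge0// invr_ge0.
have da : nonincreasing_seq a.
  apply/nonincreasing_seqP => k; rewrite /a exprS.
  by have := hu k; rewrite ler_norml => /andP[_]; lra.
have db : nondecreasing_seq b.
  apply/nondecreasing_seqP => k; rewrite /b exprS.
  by have := hu k; rewrite ler_norml => /andP[+ _]; lra.
have ba k : b k <= a k by rewrite /a /b; have := e0 k; lra.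
have lo := cvg_half_expr (2 * C).
have ca : cvgn a.
  apply: nonincreasing_is_cvgn => //; exists (b 0%N) => _ [k _ <-].
  by rewrite (le_trans _ (ba k))// db.
have cu : u @ \oo --> limn a.
  have -> : u = (fun k => a k - 2 * C * 2^-1 ^+ k).
    by apply/funext => k; rewrite /a addrK.
  by rewrite -[X in _ --> X]subr0; apply: cvgB.
have cb : b @ \oo --> limn a.
  by rewrite -[X in _ --> X]subr0; apply: cvgB.
move=> k; rewrite (cvg_lim _ cu)//.
have := nonincreasing_cvgn_ge da ca k.
have := @nondecreasing_cvgn_le _ b db (cvgP _ cb) k.
by rewrite (cvg_lim _ cb)// /a /b ler_norml; lra.
Qed.

(* The weight [expR (lam * y)] (Bielecki norm) makes a Volterra operator a
   contraction on every segment [0, T]; the iterates do not depend on [T]. *)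
Lemma volterra_fixpoint (P : (R -> R) -> R -> R) :
  (forall f, continuous0y f -> continuous0y (P f)) ->
  (forall T, 0 <= T -> exists2 lam, 0 <= lam & forall f g D,
     continuous0y f -> continuous0y g -> 0 <= D ->
     (forall y, 0 <= y <= T -> `|f y - g y| <= D * expR (lam * y)) ->
     forall y, 0 <= y <= T -> `|P f y - P g y| <= D / 2 * expR (lam * y)) ->
  exists2 f, continuous0y f & forall y, 0 <= y -> P f y = f y.
Proof.
move=> cP kP.
pose F k := iter k P (fun=> 0).
have cF k : continuous0y (F k).
  by elim: k => [|k ih]; [move=> x; exact: cvg_cst|exact: cP].
pose f y := lim (F k y @[k --> \oo]).
(* [C] is the maximum of the first Picard iterate on [0, T]. As the weight is at least 1 there, the
   contraction makes successive iterates differ by at most [C * 2^-1 ^+ k] in the weighted norm. *)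
have key T : 0 <= T -> exists lam C, [/\ 0 <= lam, 0 <= C,
    (forall g h D, continuous0y g -> continuous0y h -> 0 <= D ->
     (forall y, 0 <= y <= T -> `|g y - h y| <= D * expR (lam * y)) ->
     forall y, 0 <= y <= T -> `|P g y - P h y| <= D / 2 * expR (lam * y)) &
    forall k y, 0 <= y <= T ->
      `|F k y - f y| <= 2 * C * 2^-1 ^+ k * expR (lam * y)].
  move=> T0; have [lam lam0 hlam] := kP T T0.
  have [c cT hc] : exists2 c, c \in `[0, T] &
      forall t, t \in `[0, T] -> `|F 1%N (Num.max 0 t)| <= `|F 1%N (Num.max 0 c)|.
    apply: EVT_max => //; apply: continuous_subspaceT => x.
    by apply: cvg_norm; exact: cF.
  set C := `|F 1%N (Num.max 0 c)| in hc.
  exists lam, C; split => //; first by rewrite /C.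
  have C0 : 0 <= C by rewrite /C.
  have step k y : 0 <= y <= T ->
      `|F k.+1 y - F k y| <= C * 2^-1 ^+ k * expR (lam * y).
    elim: k y => [|k ih] y yT.
      rewrite subr0 expr0 mulr1.
      have /andP[y0 _] := yT.
      have := hc y; rewrite in_itv/= max_r// => /(_ yT) /le_trans; apply.
      by rewrite ler_peMr// -expR0 ler_expR mulr_ge0.
    have := hlam _ _ (C * 2^-1 ^+ k) (cF k.+1) (cF k) _ ih y yT.
    rewrite exprSr mulrA; apply.
    by rewrite mulr_ge0// exprn_ge0// invr_ge0.
  move=> k y yT.
  have := @geometric_steps_dist_lim (fun k => F k y) (C * expR (lam * y)).
  move=> /(_ _ k); rewrite -/(f y) [2 * C * _ * _]mulrAC -[2 * C * _]mulrA; apply.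
  by move=> j; rewrite mulrAC; exact: step.
have cf : continuous0y f.
  move=> y0; pose m := Num.max 0 y0; pose T := m + 1.
  have m0 : 0 <= m by rewrite le_max lexx.
  have T0 : 0 <= T by rewrite addr_ge0.
  have [lam [C [lam0 C0 _ hF]]] := key T T0.
  apply/cvgrPdist_le => e e0.
  have e3 : 0 < e / 3 by rewrite divr_gt0.
  have [k /ltW hk] := half_expr_lt (2 * C * expR (lam * T)) e3.
  have {}hF y : 0 <= y <= T -> `|F k y - f y| <= e / 3.
    move=> yT; apply: le_trans hk; apply: le_trans (hF k y yT) _.
    rewrite [leRHS]mulrAC ler_wpM2l//.
      by rewrite !mulr_ge0// exprn_ge0// invr_ge0.
    by rewrite ler_expR ler_wpM2l//; case/andP: yT.
  have /cvgrPdist_le cFk : F k (Num.max 0 y) @[y --> y0] --> F k m by exact: cF.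
  near=> y.
  have yT : 0 <= Num.max 0 y <= T.
    rewrite le_max lexx/= ge_max T0/=.
    have : y0 <= m by rewrite le_max lexx orbT.
    suff : y <= y0 + 1 by rewrite /T; lra.
    by apply: ltW; near: y; apply: lt_nbhsl; rewrite ltrDl.
  have mT : 0 <= m <= T by rewrite m0 /= /T lerDl ler01.
  have h1 : `|F k m - F k (Num.max 0 y)| <= e / 3 by near: y; exact: cFk.
  have := hF _ mT; have := hF _ yT; move: h1; rewrite -/m !ler_norml; lra.
(* [P (F k)] is [F k.+1], and it is geometrically close both to [P f] and to [f]; a positive gap at
   [y] is excluded by taking [k] large. *)
exists f => // y y0; apply/eqP; rewrite -subr_eq0 -normr_le0 leNgt; apply/negP => d0.
have [lam [C [lam0 C0 hP hF]]] := key y y0.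
have [k hk] := half_expr_lt (2 * C * expR (lam * y)) d0.
have yy : 0 <= y <= y by rewrite y0 lexx.
have h1 : `|P f y - P (F k) y| <= 2 * C * 2^-1 ^+ k / 2 * expR (lam * y).
  apply: hP => // [|z zy]; first by rewrite !mulr_ge0// exprn_ge0// invr_ge0.
  by rewrite distrC; exact: hF.
have h2 := hF k.+1 y yy; rewrite exprS in h2.
move: hk; apply/negP; rewrite -leNgt.
by rewrite (le_trans (ler_distD (P (F k) y) _ _))//; move: h1 h2; lra.
Unshelve. all: by end_near. Qed.

End FixedPoint.

(** * Continuity and Lipschitz estimates for the contraction *)

Section ContractionTools.
Context {R : realType}.
Implicit Types f g : R -> R.

Lemma continuous0yD f g : continuous0y f -> continuous0y g ->
  continuous0y (fun y => f y + g y).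
Proof. by move=> cf cg y; apply: cvgD; [exact: cf|exact: cg]. Qed.

Lemma continuous0yB f g : continuous0y f -> continuous0y g ->
  continuous0y (fun y => f y - g y).
Proof. by move=> cf cg y; apply: cvgB; [exact: cf|exact: cg]. Qed.

Lemma continuous0yM f g : continuous0y f -> continuous0y g ->
  continuous0y (fun y => f y * g y).
Proof. by move=> cf cg y; apply: cvgM; [exact: cf|exact: cg]. Qed.

Lemma continuous0y_max f g : continuous0y f -> continuous0y g ->
  continuous0y (fun y => Num.max (f y) (g y)).
Proof. by move=> cf cg y; apply: continuous_max; [exact: cf|exact: cg]. Qed.

Lemma continuous0y_min f g : continuous0y f -> continuous0y g ->
  continuous0y (fun y => Num.min (f y) (g y)).
Proof. by move=> cf cg y; apply: continuous_min; [exact: cf|exact: cg]. Qed.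

Lemma continuous0y_cst (c : R) : continuous0y (fun _ => c).
Proof. by move=> y; exact: cvg_cst. Qed.

Lemma continuous0y_id : continuous0y (fun y : R => y).
Proof.
by apply: continuous0y_for => y _; exact: cvg_id.
Qed.

Lemma continuous0y_expR f : continuous0y f -> continuous0y (fun y => expR (f y)).
Proof.
move=> cf y; apply: (@continuous_comp _ _ _ (fun y : R => f (Num.max 0 y)) expR).
  exact: cf.
exact: continuous_expR.
Qed.

(** Since [c / lam * expR (lam * x)] has derivative [c * expR (lam * x)], adding or subtracting the
    difference of the primitives gives nondecreasing functions that start at [c / lam >= 0]. The
    factor [1 / lam] is the gain that yields the contraction. *)
Lemma primitive0_dist f g (c lam y : R) : continuous0y f -> continuous0y g ->
  0 < lam -> 0 <= c -> 0 <= y ->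
  (forall x, 0 <= x <= y -> `|f x - g x| <= c * expR (lam * x)) ->
  `|primitive0 f y - primitive0 g y| <= c / lam * expR (lam * y).
Proof.
move=> cf cg lam0 c0 y0 fg.
have hexp (x : R) : is_derive x 1 (fun x : R => c / lam * expR (lam * x))
    (c * expR (lam * x)).
  have := is_derive1Z (c / lam) (is_derive1_expRc (is_derive1Z lam (is_derive1_id x))).
  by congr is_derive; field; rewrite gt_eqF.
have hd (x : R) : 0 <= x <= y -> is_derive x 1
    (fun x : R => primitive0 f x - primitive0 g x) (f x - g x).
  by move=> /andP[x0 _]; apply: is_derive1B; exact: is_derive_primitive0.
have cl : 0 <= c / lam by rewrite divr_ge0// ltW.
have h1 := @is_derive1_ge0_le R _ _ 0 y y0 (fun x xy => is_derive1B (hexp x) (hd x xy)).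
have h2 := @is_derive1_ge0_le R _ _ 0 y y0 (fun x xy => is_derive1D (hexp x) (hd x xy)).
rewrite !primitive00 !mulr0 expR0 !(subr0,addr0) in h1 h2.
rewrite ler_norml; apply/andP; split.
  have := h2; rewrite mulr1 => {}h2.
  suff : c / lam <= c / lam * expR (lam * y) + (primitive0 f y - primitive0 g y) by lra.
  by apply: h2 => x /fg; rewrite ler_norml => /andP[+ _]; lra.
rewrite mulr1 in h1.
suff : c / lam <= c / lam * expR (lam * y) - (primitive0 f y - primitive0 g y) by lra.
by apply: h1 => x /fg; rewrite ler_norml => /andP[_]; lra.
Qed.

(** Factor out the larger exponential and use [1 + z <= expR z] at [z = x - y]. *)
Lemma expR_lipschitz (B x y : R) : x <= B -> y <= B ->
  `|expR x - expR y| <= expR B * `|x - y|.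
Proof.
wlog xy : x y / x <= y => [hw|] xB yB.
  case: (leP x y) => [|/ltW] h; first exact: hw.
  by rewrite distrC [`|x - y|]distrC; exact: hw.
rewrite distrC ger0_norm ?subr_ge0 ?ler_expR// distrC ger0_norm ?subr_ge0//.
have -> : expR y - expR x = expR y * (1 - expR (x - y)).
  by rewrite mulrBr mulr1 -expRD addrCA subrr addr0.
have := expR_ge1Dx (x - y) => h.
have h1 : 1 - expR (x - y) <= y - x by lra.
rewrite (le_trans (ler_wpM2l (expR_ge0 y) h1))//.
by rewrite ler_wpM2r ?subr_ge0// ler_expR.
Qed.

Lemma maxr_lipschitz (l x y : R) :
  `|Num.max l x - Num.max l y| <= `|x - y|.
Proof.
wlog xy : x y / x <= y => [hw|].
  case: (leP x y) => [|/ltW] h; first exact: hw.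
  by rewrite distrC [`|x - y|]distrC; exact: hw.
rewrite distrC [`|x - y|]distrC !ger0_norm ?subr_ge0//; last first.
  by rewrite ge_max !le_max lexx xy orbT.
case: (leP l x) => lx; first by rewrite max_r// (le_trans lx).
by case: (leP l y) => ly; [rewrite lerB// ltW|rewrite subrr subr_ge0].
Qed.

(** A minimum is the opposite of a maximum of opposites, so the bound for [Num.max] applies
    twice. *)
Lemma clip_lipschitz (l u x y : R) :
  `|Num.max l (Num.min x u) - Num.max l (Num.min y u)| <= `|x - y|.
Proof.
rewrite (le_trans (maxr_lipschitz _ _ _))// -[Num.min x u]opprK -[Num.min y u]opprK.
rewrite !oppr_min -opprD normrN ![Num.max _ (- u)]maxC.
by rewrite (le_trans (maxr_lipschitz _ _ _))// -opprD normrN.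
Qed.

End ContractionTools.

(** * The logarithmic slope *)

Section LogSlope.
Context {R : realType}.
Variable b : R.
Hypothesis b0 : 0 < b.

Let q := b^-1.
Let p := 1 + q.
(** The value chosen for the free parameter [v(0)]: it lies below both [b / 16] and [1 / 16], small
    enough for the barriers that force [r] to become positive. *)
Definition slope0 := b / (16 * (1 + b)).

Definition clip (r : R -> R) (y : R) := Num.max (-1) (Num.min (r y) (1 + b + y)).
(** The explicit solution of [v' = q * clip r * v] with [v(0) = slope0]; inserting it turns the
    system into a single equation for [r]. *)
Definition clipped_v r y := slope0 * expR (q * primitive0 (clip r) y).
Definition clipped_field r y :=
  b / 2 + (y / 2 - p * clipped_v r y) * clip r y - clip r y * clip r y.

Lemma slope0_gt0 : 0 < slope0.
Proof. by rewrite divr_gt0// mulr_gt0// addr_gt0. Qed.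

Lemma slope0_lt : 16 * slope0 < b /\ 16 * slope0 < 1.
Proof.
have b1 : 0 < 1 + b by rewrite addr_gt0.
have e : 16 * slope0 = b / (1 + b) by rewrite /slope0; field; rewrite gt_eqF.
rewrite e; split; first by rewrite ltr_pdivrMr// ltr_pMr// ltrDl.
by rewrite ltr_pdivrMr// mul1r ltrDr.
Qed.

Lemma clip_continuous {r} : continuous0y r -> continuous0y (clip r).
Proof.
move=> cr; apply: continuous0y_max; first exact: continuous0y_cst.
apply: continuous0y_min => //; apply: continuous0yD; first exact: continuous0y_cst.
exact: continuous0y_id.
Qed.

Lemma clipped_v_continuous {r} : continuous0y r -> continuous0y (clipped_v r).
Proof.
move=> cr; apply: continuous0yM; first exact: continuous0y_cst.
apply: continuous0y_expR; apply: continuous0yM; first exact: continuous0y_cst.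
by apply: primitive0_continuous; exact: clip_continuous.
Qed.

Lemma clipped_field_continuous {r} : continuous0y r -> continuous0y (clipped_field r).
Proof.
move=> cr; have cc := clip_continuous cr.
apply: continuous0yB; last exact: continuous0yM.
apply: continuous0yD; first exact: continuous0y_cst.
apply: continuous0yM => //; apply: continuous0yB.
  by apply: continuous0yM; [exact: continuous0y_id|exact: continuous0y_cst].
apply: continuous0yM; first exact: continuous0y_cst.
exact: clipped_v_continuous.
Qed.

Lemma clip_norm_le r {T y : R} : 0 <= y <= T -> `|clip r y| <= 1 + b + T.
Proof.
move=> /andP[y0 yT]; rewrite /clip ler_norml.
have bT : 0 <= b + T by rewrite addr_ge0// ?(ltW b0)// (le_trans y0).
have bM : 1 <= 1 + b + T by rewrite -addrA lerDl.
apply/andP; split; first by rewrite le_max lerN2 bM.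
rewrite ge_max ge_min lerD2l yT orbT andbT.
by rewrite (le_trans _ bM).
Qed.

Lemma clipped_v_gt0 r y : 0 < clipped_v r y.
Proof. by rewrite mulr_gt0// ?slope0_gt0// expR_gt0. Qed.

Lemma clipped_exponent_le {r} {T y : R} : continuous0y r -> 0 <= y <= T ->
  q * primitive0 (clip r) y <= q * ((1 + b + T) * T).
Proof.
move=> cr /[dup] yT /andP[y0 yleT].
have T0 : 0 <= T := le_trans y0 yleT.
have M0 : 0 <= 1 + b + T by rewrite !addr_ge0// ltW.
rewrite ler_wpM2l ?invr_ge0 ?(ltW b0)//.
have h : primitive0 (fun=> 1 + b + T) y = (1 + b + T) * y - (1 + b + T) * 0.
  apply: (primitive0_unique _ (fun z => (1 + b + T) * z)) => // [|x _].
    exact: continuous0y_cst.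
  by have := is_derive1Z (1 + b + T) (is_derive1_id x); rewrite mulr1.
have -> : (1 + b + T) * T = primitive0 (fun=> 1 + b + T) y + (1 + b + T) * (T - y).
  by rewrite h; ring.
apply: ler_wpDr; first by rewrite mulr_ge0// subr_ge0.
apply: le_primitive0 => //; first exact: clip_continuous.
  exact: continuous0y_cst.
move=> x /andP[x0 xy]; apply: le_trans (ler_norm _) _; apply: clip_norm_le.
by rewrite x0 (le_trans xy).
Qed.

(** On [0, T] the clipped slope is bounded by [M] and [clipped_v] by [K], so products of them are
    Lipschitz. The constant [H] depends on [T] but not on [lam], which can therefore be chosen
    afterwards. *)
Lemma clipped_field_lipschitz (T : R) : 0 <= T -> exists2 H, 0 <= H &
  forall f g (D lam : R), continuous0y f -> continuous0y g -> 0 <= D -> 1 <= lam ->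
    (forall y, 0 <= y <= T -> `|f y - g y| <= D * expR (lam * y)) ->
    forall y, 0 <= y <= T ->
      `|clipped_field f y - clipped_field g y| <= H * D * expR (lam * y).
Proof.
move=> T0; pose M := 1 + b + T; pose K := slope0 * expR (q * (M * T)).
have M0 : 0 <= M by rewrite !addr_ge0// ltW.
have K0 : 0 <= K by rewrite mulr_ge0 ?expR_ge0// ltW// slope0_gt0.
have q0 : 0 <= q by rewrite invr_ge0 ltW.
have p0 : 0 <= p by rewrite addr_ge0.
exists (T / 2 + p * (K * q * M + K) + 2 * M).
  have KM : 0 <= p * (K * q * M + K).
    by rewrite mulr_ge0// addr_ge0// mulr_ge0// mulr_ge0.
  have MM : 0 <= 2 * M by rewrite mulr_ge0.
  by rewrite addr_ge0// addr_ge0// divr_ge0.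
move=> f g D lam cf cg D0 lam1 fg y yT.
have /andP[y0 yleT] := yT.
set e := D * expR (lam * y).
have e0 : 0 <= e by rewrite mulr_ge0// expR_ge0.
have hc x : 0 <= x <= T -> `|clip f x - clip g x| <= D * expR (lam * x).
  by move=> xT; rewrite (le_trans (clip_lipschitz _ _ _ _))// fg.
have hA : `|primitive0 (clip f) y - primitive0 (clip g) y| <= e.
  have lam0 : 0 < lam := lt_le_trans ltr01 lam1.
  apply: le_trans (primitive0_dist (clip f) (clip g) D lam y _ _ lam0 D0 y0 _) _.
  - exact: clip_continuous.
  - exact: clip_continuous.
  - by move=> x /andP[x0 xy]; apply: hc; rewrite x0 (le_trans xy).
  - by rewrite ler_wpM2r ?expR_ge0// ler_pdivrMr// ler_peMr.
have hV : `|clipped_v f y - clipped_v g y| <= K * q * e.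
  have -> : K * q * e = slope0 * (expR (q * (M * T)) * (q * e)).
    by rewrite /K; ring.
  rewrite -mulrBr normrM gtr0_norm ?slope0_gt0//.
  rewrite ler_wpM2l// ?(ltW slope0_gt0)//.
  have := expR_lipschitz _ _ _ (clipped_exponent_le cf yT) (clipped_exponent_le cg yT).
  move=> /le_trans; apply; rewrite ler_wpM2l ?expR_ge0//.
  by rewrite -mulrBr normrM ger0_norm// ler_wpM2l.
have Vg : `|clipped_v g y| <= K.
  rewrite gtr0_norm ?clipped_v_gt0// ler_wpM2l ?(ltW slope0_gt0)//.
  by rewrite ler_expR; exact: clipped_exponent_le.
have cfM := clip_norm_le f yT; have cgM := clip_norm_le g yT; rewrite -/M in cfM cgM.
have {}hc := hc y yT; rewrite -/e in hc.
rewrite /clipped_field; move: hV Vg cfM cgM hc.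
move: (clipped_v f y) (clipped_v g y) (clip f y) (clip g y).
move=> Vf Vg rf rg hV hVg hrf hrg hr.
(* Differences of products are telescoped so that each term is a difference times a bounded
   factor. *)
have -> : b / 2 + (y / 2 - p * Vf) * rf - rf * rf
    - (b / 2 + (y / 2 - p * Vg) * rg - rg * rg) =
    y / 2 * (rf - rg) - p * ((Vf - Vg) * rf + Vg * (rf - rg))
    - (rf + rg) * (rf - rg) by ring.
have -> : (T / 2 + p * (K * q * M + K) + 2 * M) * D * expR (lam * y) =
    T / 2 * e + p * ((K * q * e) * M + K * e) + (M + M) * e.
  by rewrite /e; ring.
rewrite (le_trans (ler_normB _ _))// lerD//; last first.
  by rewrite normrM ler_pM// (le_trans (ler_normD _ _))// lerD.
rewrite (le_trans (ler_normB _ _))// lerD//.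
  by rewrite normrM ler_pM// ger0_norm ?divr_ge0// ler_wpM2r// invr_ge0.
rewrite normrM ger0_norm// ler_wpM2l// (le_trans (ler_normD _ _))//.
rewrite (normrM (Vf - Vg)) (normrM Vg).
by apply: lerD; apply: ler_pM.
Qed.

Definition slope_operator r y := - slope0 + primitive0 (clipped_field r) y.

Lemma clipped_slope_exists : exists2 r, continuous0y r &
  forall y, 0 <= y -> slope_operator r y = r y.
Proof.
apply: volterra_fixpoint => [f cf|T T0].
  apply: continuous0yD; first exact: continuous0y_cst.
  by apply: primitive0_continuous; exact: clipped_field_continuous.
have [H H0 hH] := clipped_field_lipschitz T T0.
(* Integration turns the constant [H] into [H / lam], which is at most 1/2; the summand 1 provides
   [1 <= lam]. *)
pose lam := 1 + 2 * H.
have lam1 : 1 <= lam by rewrite lerDl mulr_ge0.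
have lam0 : 0 < lam := lt_le_trans ltr01 lam1.
exists lam; first exact: ltW.
move=> f g D cf cg D0 fg y /andP[y0 yT].
rewrite /slope_operator opprD addrACA subrr add0r.
apply: le_trans (primitive0_dist _ _ (H * D) lam y _ _ lam0 _ y0 _) _.
- exact: clipped_field_continuous.
- exact: clipped_field_continuous.
- exact: mulr_ge0.
- by move=> x /andP[x0 xy]; apply: hH => //; rewrite x0 (le_trans xy).
rewrite ler_wpM2r ?expR_ge0// ler_pdivrMr//.
have : 0 <= D * (lam - 2 * H) by rewrite mulr_ge0// /lam addrK.
lra.
Qed.

End LogSlope.

(** * Removal of the clipping by barriers *)

Section LogSlopeExists.
Context {R : realType}.
Variable b : R.
Hypothesis b0 : 0 < b.
Let q := b^-1.
Let p := 1 + q.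

(** The fixed point solves the clipped system, and three barriers show that clipping never acts:
    [r < 1 + b + y] throughout, a line rising to 0 below [r] on [0, 1], and [r > 0] from 1 on
    because [r' = b / 2] at a zero. *)
Lemma log_slope_exists : exists r rho : R -> R, [/\ rho 0 = 0, r 0 = - slope0 b,
  forall y : R, 0 <= y -> is_derive y 1 rho (r y),
  forall y : R, 0 <= y -> is_derive y 1 r
    (b / 2 + (y / 2 - p * (slope0 b * expR (q * rho y))) * r y - r y * r y) &
  forall y : R, 1 <= y -> 0 < r y].
Proof.
have [r cr hr] := clipped_slope_exists b b0.
(* [s] agrees with [r] on the half-line and, being built from [primitive0], has a two-sided
   derivative at [0] as well. *)
pose rho := primitive0 (clip b r); pose s := slope_operator b r.
have s0 : s 0 = - slope0 b by rewrite /s /slope_operator primitive00 addr0.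
have hs (y : R) : 0 <= y -> is_derive y 1 s (clipped_field b r y).
  move=> y0; have := is_derive1D (is_derive1_cst (- slope0 b) y)
    (is_derive_primitive0 (clipped_field_continuous b cr) y0).
  by rewrite add0r.
have v0 := slope0_gt0 b b0; have [v1 v2] := slope0_lt b b0.
have p0 : 0 < p by rewrite addr_gt0// invr_gt0.
have cs (y : R) : 0 <= y -> s y = r y by move=> y0; rewrite /s hr.
have hV (y : R) : 0 < clipped_v b r y by exact: clipped_v_gt0.
(* At contact the term [- r ^ 2] outweighs [b / 2 + x / 2 * r], and the term in [v] is nonpositive,
   so [r' < 1]. *)
have upper (y : R) : 0 <= y -> 0 < 1 + b + y - s y.
  move=> y0.
  apply: (barrier_gt0 (fun z => 1 + b + z - s z)
    (fun z => 0 + 1 - clipped_field b r z) 0 y y0 _ _ _).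
  - move=> x /andP[x0 _].
    exact: (is_derive1B (is_derive1D (is_derive1_cst (1 + b) x) (is_derive1_id x))
      (hs x x0)).
  - by rewrite s0; lra.
  - move=> x /andP[x0 _] e.
    have sx : r x = 1 + b + x by rewrite -cs ?(ltW x0)//; lra.
    have -> : clipped_field b r x = b / 2 + (x / 2 - p * clipped_v b r x) * (1 + b + x)
        - (1 + b + x) * (1 + b + x).
      suff -> : 1 + b + x = clip b r x by [].
      by rewrite /clip sx /Num.min ltxx max_r//; lra.
    have : 0 <= p * clipped_v b r x * (1 + b + x).
      apply: mulr_ge0; last by lra.
      by apply: mulr_ge0; exact: ltW.
    have bx : 0 <= b * x by rewrite mulr_ge0// ltW.
    have := sqr_ge0 b; have := sqr_ge0 x.
    move: (p * clipped_v b r x) => V; lra.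
(* The line starts at [- 2 * slope0], below [s 0 = - slope0], and reaches 0 at [y = 1]. At contact
   [r] lies between [- 2 * slope0] and 0, so [- p * v * r >= 0] and [r'] stays close to [b / 2],
   above the slope [2 * slope0] of the line. *)
have lower1 (y : R) : 0 <= y <= 1 -> - (2 * slope0 b) * (1 - y) < s y.
  move=> /andP[y0 y1]; rewrite -subr_gt0.
  apply: (barrier_gt0 (fun z => s z - - (2 * slope0 b) * (1 - z))
    (fun z => clipped_field b r z - - (2 * slope0 b) * (0 - 1)) 0 y y0 _ _ _).
  - move=> x /andP[x0 _].
    exact: (is_derive1B (hs x x0) (is_derive1Z (- (2 * slope0 b))
      (is_derive1B (is_derive1_cst 1 x) (is_derive1_id x)))).
  - by rewrite s0; lra.
  - move=> x /andP[x0 xy] /subr0_eq e.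
    have x1 : x <= 1 by exact: le_trans y1.
    have sx : r x = - (2 * slope0 b) * (1 - x) by rewrite -cs ?(ltW x0)//.
    have r0 : r x <= 0 by rewrite sx; nra.
    have r1 : - (2 * slope0 b) <= r x by rewrite sx; nra.
    have -> : clipped_field b r x = b / 2 + (x / 2 - p * clipped_v b r x) * r x
        - r x * r x.
      suff : r x = clip b r x by rewrite /clipped_field => <-.
      by rewrite /clip min_l ?max_r//; lra.
    have : p * clipped_v b r x * r x <= 0.
      by apply: mulr_ge0_le0 => //; apply: mulr_ge0; exact: ltW.
    move: (p * clipped_v b r x) => V; nra.
have s1 : 0 < s 1 by have := lower1 1; rewrite subrr mulr0 ler01 lexx; apply.
have pos (y : R) : 1 <= y -> 0 < s y.
  move=> y1; apply: (barrier_gt0 s (clipped_field b r) 1 y y1 _ s1 _).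
    by move=> x /andP[x1 _]; apply: hs; exact: le_trans x1.
  move=> x /andP[x1 _] e; have x0 : 0 <= x by rewrite (le_trans _ (ltW x1)).
  rewrite /clipped_field; suff -> : clip b r x = 0 by lra.
  by rewrite /clip -cs// e min_l ?max_r//; lra.
have noclip (y : R) : 0 <= y -> clip b r y = s y.
  move=> y0; have hu := upper y y0.
  rewrite /clip -cs// min_l; last by lra.
  rewrite max_r//; case: (leP y 1) => y1; last by have := pos y (ltW y1); lra.
  by have := lower1 y; rewrite y0 y1 => /(_ isT); nra.
exists s, rho; split => //; first exact: primitive00.
  move=> y y0; rewrite -noclip//; apply: is_derive_primitive0 => //.
  exact: clip_continuous.
by move=> y y0; have := hs y y0; rewrite /clipped_field noclip.
Qed.

End LogSlopeExists.

(** * Asymptotics of the profile *)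

Section Profile.
Context {R : realType}.
(* [b], [p], [q] stand for [beta], [p] and [p - 1]. *)
Variable b : R.
Hypothesis b0 : 0 < b.
Let q := b^-1.
Let p := 1 + q.
Variables r rho : R -> R.

(** [wprof] is [phi'] and [vprof] is its power [p - 1], that is [wprof = vprof ^ b]. Both are
    exponentials of the primitive of [r], so positivity and logarithmic derivatives are
    immediate. *)
Definition vprof (y : R) := slope0 b * expR (q * rho y).
Definition wprof (y : R) := expR (b * ln (slope0 b) + rho y).
Let v := vprof.
Let w := wprof.
Let phi := primitive0 w.

Hypothesis rho0 : rho 0 = 0.
Hypothesis r0 : r 0 = - slope0 b.
Hypothesis drho : forall y : R, 0 <= y -> is_derive y 1 rho (r y).
Hypothesis dr : forall y : R, 0 <= y ->
  is_derive y 1 r (b / 2 + (y / 2 - p * v y) * r y - r y * r y).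
Hypothesis rpos : forall y : R, 1 <= y -> 0 < r y.

Let q0 : 0 < q. Proof. by rewrite invr_gt0. Qed.
Let p0 : 0 < p. Proof. by rewrite addr_gt0. Qed.
Let bq : b * q = 1. Proof. by rewrite /q mulfV// gt_eqF. Qed.

Lemma vprof_gt0 y : 0 < v y.
Proof. by rewrite mulr_gt0 ?expR_gt0// slope0_gt0. Qed.

Lemma wprof_gt0 y : 0 < w y.
Proof. exact: expR_gt0. Qed.

Lemma is_derive_vprof (y : R) : 0 <= y -> is_derive y 1 v (q * r y * v y).
Proof.
move=> y0.
have := is_derive1Z (slope0 b) (is_derive1_expRc (is_derive1Z q (drho y y0))).
by congr is_derive; rewrite /v /vprof; ring.
Qed.

Lemma is_derive_wprof (y : R) : 0 <= y -> is_derive y 1 w (r y * w y).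
Proof.
move=> y0.
have := is_derive1_expRc
  (is_derive1D (is_derive1_cst (b * ln (slope0 b)) y) (drho y y0)).
by congr is_derive; rewrite add0r mulrC.
Qed.

Lemma wprof_continuous0y : continuous0y w.
Proof.
apply: continuous0y_for => y y0.
exact: (is_derive1_continuous (is_derive_wprof y y0)).
Qed.

Lemma is_derive_phi (y : R) : 0 <= y -> is_derive y 1 phi (w y).
Proof. by move=> y0; apply: is_derive_primitive0 => //; exact: wprof_continuous0y. Qed.

Lemma wprof_powR_q y : w y `^ q = v y.
Proof.
rewrite /powR gt_eqF ?wprof_gt0// /w /wprof expRK mulrDr mulrA [q * b]mulrC bq.
by rewrite mul1r expRD lnK// posrE slope0_gt0.
Qed.

Lemma vprof_powR_b y : v y `^ b = w y.
Proof.
by rewrite -wprof_powR_q -powRrM [q * b]mulrC bq powRr1// ltW// wprof_gt0.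
Qed.

Lemma wprof_powR_p y : w y `^ p = w y * v y.
Proof.
rewrite /p powRD; last by rewrite gt_eqF ?wprof_gt0// implybT.
by rewrite wprof_powR_q powRr1// ltW// wprof_gt0.
Qed.

(* This is the profile equation, since [w * r = phi''] and [w * v = phi' ^ p];
   its left-hand side has zero derivative. *)
Lemma profile_first_order (y : R) : 0 <= y ->
  w y * (r y - y / 2 + v y) + (1 - b) / 2 * phi y = 0.
Proof.
move=> y0.
pose E (z : R) := w z * (r z - 2^-1 * z + v z) + (1 - b) / 2 * phi z.
have dE (x : R) : 0 <= x <= y -> is_derive x 1 E 0.
  move=> /andP[x0 _].
  have := is_derive1D (is_derive1M (is_derive_wprof x x0)
    (is_derive1D (is_derive1B (dr x x0) (is_derive1Z 2^-1 (is_derive1_id x)))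
      (is_derive_vprof x x0))) (is_derive1Z ((1 - b) / 2) (is_derive_phi x x0)).
  by congr is_derive; rewrite /p; ring.
rewrite [y / 2]mulrC -[LHS]/(E y) -(is_derive1_0_eq E 0 y y0 dE).
rewrite /E mulr0 subr0 r0 /phi primitive00 mulr0 /v /vprof rho0 mulr0 expR0 mulr1.
by rewrite addNr mulr0 addr0.
Qed.

Let N (y : R) := v y * (q * r y + p / 2 * v y - 2^-1 * y).

(** By [b * q = 1] the constant from [r'] cancels the derivative of [y / 2]; the terms in
    [y * r * v] and those in [r * v ^ 2] cancel as well. What remains is
    [(q ^ 2 - q) * r ^ 2 * v]. *)
Lemma is_derive_N (y : R) : 0 <= y ->
  is_derive y 1 N ((1 - b) * (q * r y) ^+ 2 * v y).
Proof.
move=> y0.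
have := is_derive1M (is_derive_vprof y y0) (is_derive1B (is_derive1D
  (is_derive1Z q (dr y y0)) (is_derive1Z (p / 2) (is_derive_vprof y y0)))
  (is_derive1Z 2^-1 (is_derive1_id y))).
congr is_derive; rewrite /p.
have -> : q * (b / 2 + (y / 2 - (1 + q) * v y) * r y - r y * r y)
  = b * q * 2^-1 + q * (y / 2 - (1 + q) * v y) * r y - q * r y * r y by ring.
have -> : (1 - b) * (q * r y) ^+ 2 = q * r y ^+ 2 * q - (b * q) * q * r y ^+ 2 by ring.
by rewrite bq; field.
Qed.

Lemma vprof_le (x y : R) : 1 <= x -> x <= y -> v x <= v y.
Proof.
move=> x1 xy; apply: (is_derive1_ge0_le v (fun z => q * r z * v z) x y xy).
  by move=> z /andP[xz _]; apply: is_derive_vprof; lra.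
move=> z /andP[xz _]; apply: mulr_ge0; last exact: ltW (vprof_gt0 z).
by apply: mulr_ge0; apply: ltW => //; apply: rpos; lra.
Qed.

Lemma phi_gt0 (y : R) : 0 < y -> 0 < phi y.
Proof.
move=> y0; have [||c _] := is_derive1_MVT phi w 0 y; first exact: ltW.
  by move=> z /andP[z0 _]; exact: is_derive_phi.
rewrite {2}/phi primitive00 !subr0 => ->.
by apply: mulr_gt0 => //; exact: wprof_gt0.
Qed.

(* The barrier is [k (y - A)]: it vanishes at [A], where [v] is already bounded
   below by [v 1]. *)
Lemma vprof_linear_lower (sig tau c k : R) : 0 <= k -> tau * k < sig -> 0 <= tau ->
  (forall y, 1 <= y -> v y * (sig * y - c - tau * v y) <= q * r y * v y) ->
  exists2 A, 1 <= A & forall y, A <= y -> k * (y - A) <= v y.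
Proof.
move=> k0 ks tau0 hv.
pose d := v 1; have d0 : 0 < d := vprof_gt0 1.
pose m := sig - tau * k; have m0 : 0 < m by rewrite subr_gt0.
(* For [x >= A] this gives [m * x >= |c| + k / d + 1]. At contact [v x <= k * x], so the bracket in
   the hypothesis is at least [k / d + 1]; times [v x >= d] it exceeds the slope [k]. *)
pose A := 1 + (`|c| + k / d + 1) / m.
have kd0 : 0 <= k / d by rewrite divr_ge0// ltW.
have A1 : 1 <= A.
  by rewrite lerDl divr_ge0// ?(ltW m0)// addr_ge0// addr_ge0.
have A0 : 0 <= A := le_trans ler01 A1.
exists A => // y Ay; rewrite -subr_ge0; apply: ltW.
apply: (barrier_gt0 (fun z => v z - k * (z - A))
  (fun z => q * r z * v z - k * (1 - 0)) A y Ay).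
- move=> x /andP[Ax _]; have x0 : 0 <= x by rewrite (le_trans A0).
  exact: (is_derive1B (is_derive_vprof x x0) (is_derive1Z k
    (is_derive1B (is_derive1_id x) (is_derive1_cst A x)))).
- by rewrite subrr mulr0 subr0 vprof_gt0.
move=> x /andP[Ax _] /subr0_eq e.
have x1 : 1 <= x by rewrite (le_trans A1)// ltW.
have mx : `|c| + k / d + 1 <= m * x.
  have : m * A <= m * x by rewrite ler_pM2l// ltW.
  apply: le_trans; rewrite /A mulrDr mulr1 [m * (_ / m)]mulrCA divff ?gt_eqF// mulr1.
  by rewrite lerDr ltW.
have vk : v x <= k * x by rewrite e ler_wpM2l// lerBlDr lerDl.
have br : k / d + 1 <= sig * x - c - tau * v x.
  have : tau * v x <= tau * (k * x) by rewrite ler_wpM2l.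
  have : c <= `|c| by exact: ler_norm.
  by move: mx; rewrite /m; lra.
rewrite subr0 mulr1 subr_gt0; apply: lt_le_trans (hv x x1).
have dv : d <= v x by exact: vprof_le.
apply: (@lt_le_trans _ _ (d * (k / d + 1))).
  by rewrite mulrDr mulr1 mulrCA divff ?gt_eqF// mulr1 ltrDl.
by rewrite ler_pM// ?(ltW d0)// addr_ge0.
Qed.

(* For [b >= 1] the coefficient of [phi] in the first-order equation is
   nonpositive, so [r y >= y / 2 - v y]; for [b <= 1] the quantity [N] is
   nondecreasing. *)
Lemma vprof_lower : exists k A, [/\ 1 < 2 * (p * k), 0 <= k, 1 <= A &
  forall y, A <= y -> k * (y - A) <= v y].
Proof.
have [b1|b1] := leP 1 b.
  have q1 : q <= 1 by rewrite invf_le1.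
  (* The midpoint of [1 / (2 * p)], the threshold to be exceeded, and [1 / 2], the ratio of
     [sig = q / 2] to [tau = q]. *)
  pose k := (p^-1 + 1) / 4.
  have pk : p * k = (1 + p) / 4 by rewrite /k mulrA mulrDr divff ?gt_eqF// mulr1.
  have k0 : 0 <= k by rewrite divr_ge0// addr_ge0// invr_ge0 ltW.
  have k12 : k < 2^-1.
    have : p^-1 < 1 by rewrite invf_lt1// ltrDl.
    by rewrite /k; lra.
  have [|||A A1 hA] := vprof_linear_lower (q / 2) q 0 k k0.
  - by rewrite ltr_pM2l.
  - exact: ltW.
  - move=> y y1; have y0 : 0 <= y := le_trans ler01 y1.
    rewrite subr0 [leLHS]mulrC ler_wpM2r// ?(ltW (vprof_gt0 y))//.
    have -> : q / 2 * y - q * v y = q * (y / 2 - v y) by ring.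
    rewrite ler_wpM2l// ?(ltW q0)//.
    have := profile_first_order y y0; move/eqP; rewrite addr_eq0 => /eqP e.
    have : 0 <= w y * (r y - y / 2 + v y).
      have phi_ge0 : 0 <= phi y by apply: ltW; apply: phi_gt0; lra.
      rewrite e -mulNr mulr_ge0//.
      by rewrite -mulNr divr_ge0// opprB subr_ge0.
    by rewrite pmulr_rge0 ?wprof_gt0//; lra.
  by exists k, A; split => //; rewrite pk; have := q0; rewrite /p; lra.
(* The midpoint of [1 / (2 * p)] and [1 / p], the latter being the ratio of [sig = 1 / 2] to
   [tau = p / 2]. *)
pose k := (3 / 4) / p.
have pk : p * k = 3 / 4 by rewrite /k mulrCA divff ?gt_eqF// mulr1.
have k0 : 0 <= k by rewrite divr_ge0// ltW.
have Nincr y : 1 <= y -> N 1 <= N y.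
  move=> y1; apply: (is_derive1_ge0_le N
    (fun z => (1 - b) * (q * r z) ^+ 2 * v z) 1 y y1).
    by move=> z /andP[z1 _]; apply: is_derive_N; lra.
  move=> z _; apply: mulr_ge0; last exact: ltW (vprof_gt0 z).
  by rewrite mulr_ge0 ?sqr_ge0// subr_ge0 ltW.
(* Dividing [N y >= N 1] by [v y >= v 1] bounds the bracket in [N] below by [- |N 1| / v 1], whence
   the constant [c]. *)
have [|||A A1 hA] := vprof_linear_lower 2^-1 (p / 2) (`|N 1| / v 1) k k0.
- by rewrite mulrAC pk; lra.
- by rewrite divr_ge0// ltW.
- move=> y y1; rewrite [leRHS]mulrC ler_wpM2l ?(ltW (vprof_gt0 y))//.
  have v10 : 0 < v 1 := vprof_gt0 1.
  have h1 : - (`|N 1| / v 1) * v y <= v y * (q * r y + p / 2 * v y - 2^-1 * y).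
    apply: le_trans (Nincr y y1).
    apply: (@le_trans _ _ (- `|N 1|)); last first.
      by have := ler_norm (- N 1); rewrite normrN; lra.
    rewrite mulNr lerN2 -mulrA ler_peMr//.
    by rewrite mulrC ler_pdivlMr// mul1r vprof_le.
  by move: h1; rewrite [leLHS]mulrC ler_pM2l ?vprof_gt0//; lra.
by exists k, A; split => //; rewrite pk; lra.
Qed.

(** Once [p * v - y / 2 >= m * y], the derivative of [y * r] is at most
    [r + b * y / 2 - m * y * (y * r)]. At contact with [C], half of the last term absorbs [r]
    because [m * y >= 2], and the other half absorbs [b * y / 2] because [m * C > 2 * b]. *)
Lemma r_decay : exists C Y, [/\ 0 < C, 1 <= Y & forall y, Y <= y -> y * r y < C].
Proof.
have [k [A [pk k0 A1 hA]]] := vprof_lower.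
(* Half of the margin of [p * k] over 1/2: the other half absorbs the shift [p * k * A] for
   [y >= Y]. *)
pose m := (p * k - 2^-1) / 2.
have m0 : 0 < m by rewrite divr_gt0//; lra.
pose Y := 1 + p * k * A / m + 2 / m.
have A0 : 0 <= A := le_trans ler01 A1.
have pkA0 : 0 <= p * k * A.
  by apply: mulr_ge0 => //; apply: mulr_ge0 => //; exact: ltW.
have pkA : 0 <= p * k * A / m by rewrite divr_ge0// ltW.
have m2 : 0 <= 2 / m by rewrite divr_ge0// ltW.
have Y1 : 1 <= Y by rewrite /Y; lra.
have hm y : Y <= y -> [/\ p * k * A <= m * y & 2 <= m * y].
  move=> Yy; have : m * Y <= m * y by rewrite ler_pM2l.
  have -> : m * Y = m + p * k * A + 2 by rewrite /Y; field; rewrite gt_eqF.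
  by split; lra.
have AY : A <= Y.
  have : A <= p * k * A / m.
    rewrite ler_pdivlMr// mulrC ler_wpM2r//.
    by rewrite /m; lra.
  by rewrite /Y; lra.
have hv y : Y <= y -> m * y <= p * v y - y / 2.
  move=> Yy; have [h1 _] := hm y Yy.
  have : p * (k * (y - A)) <= p * v y.
    by rewrite ler_pM2l// hA// (le_trans AY).
  rewrite /m in h1 *; lra.
(* The first two summands put the barrier above [y * r] at [Y]; the last one gives
   [m * C > 2 * b]. *)
pose C := `|Y * r Y| + 1 + 2 * b / m.
have bm : 0 < 2 * b / m by rewrite divr_gt0// mulr_gt0.
have C0 : 0 < C by rewrite /C; have := normr_ge0 (Y * r Y); lra.
exists C, Y; split => // y Yy; rewrite -subr_gt0.
apply: (barrier_gt0 (fun z => C - z * r z)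
  (fun z => 0 - (1 * r z + z * (b / 2 + (z / 2 - p * v z) * r z - r z * r z))) Y y Yy).
- move=> x /andP[Yx _]; have x0 : 0 <= x by rewrite (le_trans _ Yx)// (le_trans ler01).
  exact: (is_derive1B (is_derive1_cst C x) (is_derive1M (is_derive1_id x) (dr x x0))).
- by rewrite subr_gt0 /C; have := ler_norm (Y * r Y); lra.
move=> x /andP[Yx _] /subr0_eq e.
have {}Yx := ltW Yx; have x1 : 1 <= x := le_trans Y1 Yx.
have [_ h2] := hm x Yx; have h3 := hv x Yx.
have rx : 0 < r x by exact: rpos.
have mC : 2 * b < m * C.
  have -> : m * C = m * (`|Y * r Y| + 1) + 2 * b by rewrite /C; field; rewrite gt_eqF.
  by rewrite ltrDr mulr_gt0// ltr_wpDl.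
have h4 : m * x * (x * r x) <= (p * v x - x / 2) * (x * r x).
  by rewrite ler_wpM2r// mulr_ge0// ltW//; lra.
have h5 : 2 * b * x < m * C * x by rewrite ltr_pM2r//; lra.
have h6 : 2 * r x <= m * x * r x by rewrite ler_pM2r.
have h7 : m * x * r x <= m * x * r x * x.
  by rewrite ler_peMr// mulr_ge0 ?(ltW rx)//; lra.
have h8 : 0 <= x * (r x * r x) by rewrite !mulr_ge0 ?(ltW rx)//; lra.
rewrite e in h5.
have bx : 0 < b * x by rewrite mulr_gt0//; lra.
lra.
Qed.

(** Boundedness of [r] gives [|N'| <= K * v'], hence [|N| <= |N Y| + K * v]. Dividing by [v], which
    stays above [v Y], bounds [q * r + p * v / 2 - y / 2], where [q * r] is itself bounded. *)
Lemma vprof_asymptotic : exists C Y, [/\ 0 <= C, 1 <= Y &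
  forall y, Y <= y -> `|p * v y - y| <= C].
Proof.
have [C [Y [C0 Y1 hC]]] := r_decay.
pose K := `|1 - b| * q * C.
have K0 : 0 <= K.
  by apply: mulr_ge0; [apply: mulr_ge0 => //|]; exact: ltW.
have Y0 : 0 <= Y := le_trans ler01 Y1.
have rC y : Y <= y -> 0 < r y < C.
  move=> Yy; have y1 : 1 <= y := le_trans Y1 Yy; have := rpos y y1 => ry.
  rewrite ry/=; apply: le_lt_trans (hC y Yy).
  by rewrite ler_peMl// ltW.
have dN (x : R) : Y <= x ->
    `|(1 - b) * (q * r x) ^+ 2 * v x| <= K * (q * r x * v x).
  move=> Yx; have /andP[rx0 rxC] := rC x Yx.
  have qrv : 0 <= q * r x * v x.
    by apply: mulr_ge0; [apply: mulr_ge0|]; apply: ltW => //; exact: vprof_gt0.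
  have -> : (1 - b) * (q * r x) ^+ 2 * v x = (1 - b) * (q * r x) * (q * r x * v x).
    by ring.
  rewrite normrM (ger0_norm qrv) ler_wpM2r// normrM.
  rewrite (ger0_norm (mulr_ge0 (ltW q0) (ltW rx0))) /K -mulrA.
  by rewrite ler_wpM2l// ler_wpM2l// ltW.
have hN y : Y <= y -> `|N y| <= `|N Y| + K * v y.
  move=> Yy.
  have vY : 0 <= K * v Y by apply: mulr_ge0 => //; exact: ltW (vprof_gt0 Y).
  have dNK (x : R) : Y <= x <= y -> is_derive x 1 N ((1 - b) * (q * r x) ^+ 2 * v x)
      /\ is_derive x 1 (fun z => K * v z) (K * (q * r x * v x)).
    move=> /andP[Yx _]; have x0 := le_trans Y0 Yx.
    split; first exact: is_derive_N.
    exact: (is_derive1Z K (is_derive_vprof x x0)).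
  have h1 : K * v Y - N Y <= K * v y - N y.
    apply: (is_derive1_ge0_le (fun z => K * v z - N z) (fun x => K * (q * r x * v x)
      - (1 - b) * (q * r x) ^+ 2 * v x) Y y Yy) => x.
      by move=> xy; have [h h'] := dNK x xy; exact: (is_derive1B h' h).
    by move=> /andP[/dN + _]; rewrite ler_norml => /andP[_]; rewrite subr_ge0.
  have h2 : K * v Y + N Y <= K * v y + N y.
    apply: (is_derive1_ge0_le (fun z => K * v z + N z) (fun x => K * (q * r x * v x)
      + (1 - b) * (q * r x) ^+ 2 * v x) Y y Yy) => x.
      by move=> xy; have [h h'] := dNK x xy; exact: (is_derive1D h' h).
    move=> /andP[/dN + _]; rewrite ler_norml => /andP[+ _].
    by rewrite -subr_ge0 opprK addrC.
  have := ler_norm (N Y); have := ler_norm (- N Y); rewrite normrN.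
  by move: h1 h2; rewrite ler_norml; lra.
pose K2 := `|N Y| / v Y + K.
have vY0 := vprof_gt0 Y.
have K20 : 0 <= K2 by rewrite addr_ge0// divr_ge0// ltW.
(* The factor 2 undoes the halves in the bracket of [N]. *)
exists (2 * (K2 + q * C)), Y; split => //.
  by rewrite mulr_ge0// addr_ge0// mulr_ge0// ltW.
move=> y Yy; have /andP[r0' rC'] := rC y Yy.
have vy0 := vprof_gt0 y.
have : `|N y| <= v y * K2.
  apply: le_trans (hN y Yy) _; rewrite /K2 mulrDr [v y * K]mulrC lerD2r.
  rewrite mulrCA ler_peMr// ler_pdivlMr// mul1r; exact: vprof_le.
rewrite /N normrM gtr0_norm// ler_pM2l//.
have : q * r y <= q * C by rewrite ler_wpM2l// ltW.
have : 0 <= q * r y by rewrite mulr_ge0// ltW.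
by rewrite !ler_norml; lra.
Qed.

(** For large [y] the ratio is the power [c] of [1 + a / y], and this power is continuous at 1. *)
Lemma cvg_powR_shift_ratio (a c : R) : 0 <= c ->
  (y + a) `^ c / y `^ c @[y --> +oo] --> (1 : R).
Proof.
move=> c0.
have h1 : 1 + a * y^-1 @[y --> +oo] --> (1 : R).
  rewrite -[X in _ --> X]addr0 -[X in _ --> _ + X](mulr0 a).
  apply: cvgD; first exact: cvg_cst.
  by apply: cvgMr; apply/gtr0_cvgV0; [exact: nbhs_pinfty_gt|exact: cvg_id].
have h : (1 + a * y^-1) `^ c @[y --> +oo] --> (1 : R).
  have hc := is_derive1_continuous (@is_derive1_powR R c 1 ltr01).
  by have := continuous_cvg _ hc h1; rewrite /= powR1; exact.
apply: cvg_trans h; apply: near_eq_cvg; near=> y.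
have y0 : 0 < y by near: y; apply: nbhs_pinfty_gt; rewrite num_real.
have ya : 0 < y + a.
  have : - a < y by near: y; apply: nbhs_pinfty_gt; rewrite num_real.
  lra.
have -> : y + a = (1 + a * y^-1) * y.
  by rewrite mulrDl mul1r divfK// gt_eqF.
rewrite powRM ?(ltW y0)//; last first.
  have -> : 1 + a * y^-1 = (y + a) / y by rewrite mulrDl divff// gt_eqF.
  by rewrite divr_ge0// ltW.
by rewrite mulfK// gt_eqF// powR_gt0.
Unshelve. all: by end_near. Qed.

Lemma cvg_inv_powR (c : R) : 0 < c -> (y `^ c)^-1 @[y --> +oo] --> (0 : R).
Proof.
move=> c0; apply/cvgrPdist_le => e e0; near=> y.
have y0 : 0 < y by near: y; apply: nbhs_pinfty_gt; rewrite num_real.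
have hy : e^-1 `^ c^-1 <= y by near: y; apply: nbhs_pinfty_ge; rewrite num_real.
rewrite sub0r normrN gtr0_norm ?invr_gt0 ?powR_gt0// -[leRHS]invrK.
rewrite lef_pV2 ?posrE ?powR_gt0 ?invr_gt0//.
have -> : e^-1 = (e^-1 `^ c^-1) `^ c.
  by rewrite -powRrM mulVf ?gt_eqF// powRr1// invr_ge0 ltW.
by apply: ge0_ler_powR; rewrite ?nnegrE ?powR_ge0 ?(ltW c0)// ltW.
Unshelve. all: by end_near. Qed.

Lemma is_derive_powR_shift (a y : R) : 0 < y + a ->
  is_derive y 1 (fun z => (z + a) `^ (b + 1) / (b + 1)) ((y + a) `^ b).
Proof.
move=> ya.
have h := @is_derive1_powR R (b + 1) (y + a) ya.
have := is_derive1Z (b + 1)^-1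
  (@is_derive1_funcomp R (fun z : R => z `^ (b + 1)) (fun z : R => z + a) y _ _ h
    (is_derive1D (is_derive1_id y) (is_derive1_cst a y))).
have -> : (b + 1)^-1 * ((b + 1) * (y + a) `^ (b + 1 - 1) * (1 + 0)) = (y + a) `^ b.
  by rewrite addr0 mulr1 mulKf ?addrK// gt_eqF// addr_gt0.
by under [X in is_derive _ _ X _ -> _]funext do rewrite mulrC.
Qed.

(** From [w = v ^ b] and [|p * v - y| <= C], [w] lies between [l * (y - C) ^ b] and
    [l * (y + C) ^ b]. Comparison with the primitives [g (- C)] and [g C] squeezes [phi], and shifts
    and constants vanish in the ratio. *)
Lemma phi_asymptotic :
  phi y / y `^ (b + 1) @[y --> +oo] --> p^-1 `^ b / (b + 1).
Proof.
have [C [Y [C0 Y1 hC]]] := vprof_asymptotic.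
pose l := p^-1 `^ b; pose Z := Y + C.
have YZ : Y <= Z by rewrite lerDl.
have l0 : 0 < l by rewrite powR_gt0// invr_gt0.
have b10 : 0 < b + 1 by rewrite addr_gt0.
pose g a z : R := l * ((z + a) `^ (b + 1) / (b + 1)).
have wbound y : Z <= y -> l * (y - C) `^ b <= w y <= l * (y + C) `^ b.
  move=> Zy; have := hC y (le_trans YZ Zy); rewrite ler_norml => hv.
  have yC : 0 <= y - C by move: Zy; rewrite /Z; lra.
  have yC' : 0 <= y + C by lra.
  have pi0 : 0 <= p^-1 by rewrite invr_ge0 ltW.
  have v0 : 0 <= v y := ltW (vprof_gt0 y).
  have pC : 0 <= p^-1 * (y - C) by exact: mulr_ge0.
  have pC' : 0 <= p^-1 * (y + C) by exact: mulr_ge0.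
  rewrite -!powRM// -vprof_powR_b; apply/andP; split; apply: ge0_ler_powR;
    rewrite ?nnegrE ?(ltW b0)//.
    by rewrite mulrC ler_pdivrMr//; lra.
  by rewrite [leRHS]mulrC ler_pdivlMr//; lra.
have dg a (x : R) : 0 < x + a -> is_derive x 1 (g a) (l * (x + a) `^ b).
  by move=> xa; exact: (is_derive1Z l (is_derive_powR_shift a x xa)).
have low y : Z <= y -> phi Z - g (- C) Z <= phi y - g (- C) y.
  move=> Zy; apply: (is_derive1_ge0_le (fun z => phi z - g (- C) z)
    (fun z => w z - l * (z - C) `^ b) Z y Zy) => x /andP[Zx _].
    apply: (is_derive1B (is_derive_phi x _) (dg (- C) x _));
      move: Zx; rewrite /Z; lra.
  by rewrite subr_ge0; have /andP[] := wbound x Zx.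
have upp y : Z <= y -> g C Z - phi Z <= g C y - phi y.
  move=> Zy; apply: (is_derive1_ge0_le (fun z => g C z - phi z)
    (fun z => l * (z + C) `^ b - w z) Z y Zy) => x /andP[Zx _].
    apply: (is_derive1B (dg C x _) (is_derive_phi x _));
      move: Zx; rewrite /Z; lra.
  by rewrite subr_ge0; have /andP[] := wbound x Zx.
have cg a k : (k + g a y) / y `^ (b + 1) @[y --> +oo] --> l / (b + 1).
  have -> : (fun y => (k + g a y) / y `^ (b + 1)) = (fun y =>
      k * (y `^ (b + 1))^-1 + l / (b + 1) * ((y + a) `^ (b + 1) / y `^ (b + 1))).
    by apply/funext => y; rewrite /g; ring.
  rewrite -[X in _ --> X]add0r -[X in _ --> X + _](mulr0 k).
  rewrite -[X in _ --> _ + X]mulr1.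
  apply: cvgD; first by apply: cvgMr; exact: cvg_inv_powR.
  by apply: cvgMr; apply: cvg_powR_shift_ratio; exact: ltW.
apply: (squeeze_cvgr _ (cg (- C) (phi Z - g (- C) Z)) (cg C (phi Z - g C Z))).
near=> y.
have Zy : Z <= y by near: y; apply: nbhs_pinfty_ge; rewrite num_real.
rewrite !ler_wpM2r ?invr_ge0 ?powR_ge0//; first by have := upp y Zy; lra.
by have := low y Zy; lra.
Unshelve. all: by end_near. Qed.

End Profile.

(** * The self-similar solution *)

Section SelfSimilar.
Context {R : realType} {n : nat}.
Notation pt := 'rV[R]_n.+1.
Implicit Types (x : pt) (t : R) (g : R -> R).

(** The difference quotient along [v] is that of [g] along the scalar [lastc v], and the
    differential is linear. *)
Lemma is_derive_lastc (g : R -> R) (x v : pt) (d : R) :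
  is_derive (lastc x) 1 g d -> is_derive x v (fun z => g (lastc z)) (lastc v * d).
Proof.
move=> hg; have [dg gd] := hg.
have /derivable1_diffP dfg := dg.
have eqf : (fun h : R => h^-1 *: ((((fun z => g (lastc z)) \o shift x) (h *: v)
    : R) - g (lastc x))) =
  (fun h : R => h^-1 *: (((g \o shift (lastc x)) (h *: lastc v) : R) - g (lastc x))).
  by apply/funext => h /=; rewrite /lastc !mxE.
have dv : derivable g (lastc x) (lastc v) by exact: diff_derivable.
split.
  by move: dv; rewrite /derivable -eqf.
rewrite /derive eqf -[LHS]/('D_(lastc v) g (lastc x)) -gd !deriveE//.
by rewrite -[X in 'd _ _ X]mulr1 linearZ.
Qed.

Lemma lastc_evec (i : 'I_n.+1) : lastc (evec R i) = (i == ord_max)%:R :> R.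
Proof. by rewrite /lastc /evec mxE eqxx eq_sym. Qed.

Lemma lastc_continuous : continuous (@lastc R n).
Proof. by move=> x; exact: coord_continuous. Qed.

Lemma is_derive_oppr_powR (c t : R) : t < 0 ->
  is_derive t 1 (fun s => (- s) `^ c) (- (c * (- t) `^ (c - 1))).
Proof.
move=> t0; have nt : 0 < - t by rewrite oppr_gt0.
have := @is_derive1_funcomp R (fun z : R => z `^ c) (fun s => - s) t _ _
  (@is_derive1_powR R c (- t) nt) (is_derive1N (is_derive1_id t)).
by rewrite mulrN1.
Qed.

(** For [t < 0] this is [selfsim] with only powers of [- t]. The family is stable under
    differentiation: the exponent drops by 1/2 for a derivative in space and by 1 for one in
    time. *)
Definition similar (c : R) g x t : R := (- t) `^ c * g (lastc x * (- t) `^ (- 2^-1)).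

Lemma selfsimE c g x t : t < 0 -> selfsim c g x t = similar c g x t.
Proof.
move=> t0; rewrite /selfsim /similar ltr0_norm// powRN powR12_sqrt//.
by rewrite oppr_ge0 ltW.
Qed.

Lemma similar_continuous c g x t : t < 0 ->
  {for lastc x * (- t) `^ (- 2^-1), continuous g} ->
  {for (x, t), continuous (fun z : pt * R => similar c g z.1 z.2)}.
Proof.
move=> t0 cg.
have cp e : (- z.2) `^ e @[z --> (x, t)] --> (- t) `^ e.
  have h : {for t, continuous (fun s : R => (- s) `^ e)}.
    exact: is_derive1_continuous (is_derive_oppr_powR e t t0).
  apply: (@continuous_cvg _ _ _ (nbhs (x, t)) _ snd _ t h); exact: cvg_snd.
have cl : lastc z.1 @[z --> (x, t)] --> lastc x.
  apply: (@continuous_cvg _ _ _ (nbhs (x, t)) _ fst _ x (lastc_continuous x)).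
  exact: cvg_fst.
apply: cvgM; first exact: cp.
by apply: (@continuous_cvg _ _ _ (nbhs (x, t)) _
  (fun z : pt * R => lastc z.1 * (- z.2) `^ (- 2^-1)) g _ cg);
  apply: cvgM; [exact: cl|exact: cp].
Qed.

Lemma near_Qset x t : Qset (x, t) -> \forall z \near (x, t), Qset z.
Proof.
move=> [/= x0 t0]; near=> z; split.
  near: z; apply: cvgr_gt x0.
  apply: (@continuous_cvg _ _ _ (nbhs (x, t)) _ fst _ x (lastc_continuous x)).
  exact: cvg_fst.
by near: z; apply: cvgr_lt t0; exact: cvg_snd.
Unshelve. all: by end_near. Qed.

(** The closed forms of the partial derivatives hold on [Q] only; as [Q] is open, continuity still
    transfers. *)
Lemma continuous_on_Q (f h : pt -> R -> R) x t : Qset (x, t) ->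
  (forall y s, Qset (y, s) -> f y s = h y s) ->
  {for (x, t), continuous (fun z : pt * R => h z.1 z.2)} ->
  {for (x, t), continuous (fun z : pt * R => f z.1 z.2)}.
Proof.
move=> xt fh ch.
suff : f z.1 z.2 @[z --> (x, t)] --> f x t by [].
rewrite (fh x t xt); apply: cvg_trans ch; apply: near_eq_cvg.
by apply: filterS (near_Qset x t xt) => -[y s] /fh.
Qed.

(** * From the profile equation to the half-space problem *)

Section Ancient.
Variables (p : R) (phi phi1 phi2 : R -> R).
Hypothesis p1 : 1 < p.
Let gam : R := (p - 2) / (2 * (p - 1)).
Hypothesis phi0 : phi 0 = 0.
Hypothesis dphi : forall y : R, 0 <= y -> is_derive y 1 phi (phi1 y).
Hypothesis dphi1 : forall y : R, 0 <= y -> is_derive y 1 phi1 (phi2 y).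
Hypothesis cphi2 : forall y : R, 0 <= y -> {for y, continuous phi2}.
Hypothesis phi1_ge0 : forall y : R, 0 <= y -> 0 <= phi1 y.
Hypothesis profile_eq : forall y : R, 0 <= y ->
  phi2 y = y / 2 * phi1 y - gam * phi y - phi1 y `^ p.

Let u : pt -> R -> R := @selfsim R n gam phi.

Let Y x t : R := lastc x * (- t) `^ (- 2^-1).

Let Y_ge0 x t : 0 <= lastc x -> 0 <= Y x t.
Proof. by move=> x0; rewrite mulr_ge0// powR_ge0. Qed.

Let powRS (t c d : R) : t < 0 -> (- t) `^ c * (- t) `^ d = (- t) `^ (c + d).
Proof. by move=> t0; rewrite powRD// oppr_eq0 (lt_eqF t0) implybT. Qed.

Lemma is_derive_similar (c : R) (g : R -> R) x t (d : R) (v : pt) : t < 0 ->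
  is_derive (Y x t) 1 g d ->
  is_derive x v (fun z => similar c g z t) (lastc v * ((- t) `^ (c - 2^-1) * d)).
Proof.
move=> t0 gd; apply: (is_derive_lastc (fun s => (- t) `^ c * g (s * (- t) `^ (- 2^-1)))).
have := is_derive1Z ((- t) `^ c) (@is_derive1_funcomp R g
  (fun s => s * (- t) `^ (- 2^-1)) (lastc x) _ _ gd
  (is_derive1M (is_derive1_id (lastc x))
    (is_derive1_cst ((- t) `^ (- 2^-1)) (lastc x)))).
by rewrite mulr0 addr0 mul1r mulrCA mulrC powRS.
Qed.

Lemma pdx_selfsim i x t : Qset (x, t) ->
  is_derive x (evec R i) (fun z => u z t)
    ((i == ord_max)%:R * similar (gam - 2^-1) phi1 x t).
Proof.
move=> [/= x0 t0].
have -> : (fun z => u z t) = (fun z => similar gam phi z t).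
  by apply/funext => z; exact: selfsimE.
rewrite -lastc_evec; apply: is_derive_similar => //.
by apply: dphi; apply: Y_ge0; exact: ltW.
Qed.

Lemma pdxE i x t : Qset (x, t) ->
  pdx i u x t = (i == ord_max)%:R * similar (gam - 2^-1) phi1 x t.
Proof. by move=> xt; have [_] := pdx_selfsim i x t xt. Qed.

Lemma pdxx_selfsim i j x t : Qset (x, t) ->
  is_derive x (evec R i) (fun z => pdx j u z t)
    ((i == ord_max)%:R * (j == ord_max)%:R * similar (gam - 1) phi2 x t).
Proof.
move=> [/= x0 t0].
have hd : is_derive x (evec R i)
    (fun z => (j == ord_max)%:R * similar (gam - 2^-1) phi1 z t)
    ((i == ord_max)%:R * (j == ord_max)%:R * similar (gam - 1) phi2 x t).
  have h : is_derive x (evec R i) (similar (gam - 2^-1) phi1 ^~ t) _ :=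
    is_derive_similar (gam - 2^-1) phi1 x t _ (evec R i) t0
      (dphi1 _ (Y_ge0 x t (ltW x0))).
  have := @is_deriveZ _ _ _ _ (j == ord_max)%:R _ _ _ h.
  have -> : gam - 2^-1 - 2^-1 = gam - 1 by field.
  rewrite lastc_evec; congr is_derive.
  by rewrite /GRing.scale /= mulrCA mulrA.
apply: near_eq_is_derive hd; near=> z; rewrite pdxE//; split => //.
near: z; apply: cvgr_gt x0; exact: lastc_continuous.
Unshelve. all: by end_near. Qed.

Lemma pdxxE i j x t : Qset (x, t) -> pdxx i j u x t =
  (i == ord_max)%:R * (j == ord_max)%:R * similar (gam - 1) phi2 x t.
Proof. by move=> xt; have [_] := pdxx_selfsim i j x t xt. Qed.

Lemma pdt_selfsim x t : Qset (x, t) -> is_derive t 1 (fun s => u x s)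
  (similar (gam - 1) (fun y => y / 2 * phi1 y - gam * phi y) x t).
Proof.
move=> [/= x0 t0].
have hd : is_derive t 1 (fun s => similar gam phi x s)
    (similar (gam - 1) (fun y => y / 2 * phi1 y - gam * phi y) x t).
  have := is_derive1M (is_derive_oppr_powR gam t t0)
    (@is_derive1_funcomp R phi (fun s => Y x s) t _ _
      (dphi _ (Y_ge0 x t (ltW x0)))
      (is_derive1Z (lastc x) (is_derive_oppr_powR (- 2^-1) t t0))).
  congr is_derive; rewrite /similar -/(Y x t).
  have -> : (- t) `^ gam = (- t) `^ (gam - 1) * (- t).
    by rewrite -[X in _ * X]powRr1 ?powRS ?subrK// oppr_ge0 ltW.
  have -> : (- t) `^ (- 2^-1 - 1) = (- t) `^ (- 2^-1) * (- t)^-1.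
    by rewrite -powRS// (powRN _ 1) powRr1// oppr_ge0 ltW.
  by rewrite /Y; field; rewrite lt_eqF.
apply: near_eq_is_derive hd; near=> s; rewrite /u selfsimE//.
near: s; exact: lt_nbhsl.
Unshelve. all: by end_near. Qed.

Lemma pdtE x t : Qset (x, t) ->
  pdt u x t = similar (gam - 1) (fun y => y / 2 * phi1 y - gam * phi y) x t.
Proof. by move=> xt; have [_] := pdt_selfsim x t xt. Qed.

Lemma selfsim_C21 : C21_on_Q u.
Proof.
move=> x t xt; have [/= x0 t0] := xt; have y0 := Y_ge0 x t (ltW x0).
have c0 := is_derive1_continuous (dphi _ y0).
have c1 := is_derive1_continuous (dphi1 _ y0).
split; first by move=> i; have [] := pdx_selfsim i x t xt.
split; first by move=> i j; have [] := pdxx_selfsim i j x t xt.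
split; first by have [] := pdt_selfsim x t xt.
split.
  apply: (continuous_on_Q u (similar gam phi) x t xt).
    by move=> y s [_ s0]; exact: selfsimE.
  exact: similar_continuous.
split.
  move=> i; apply: (continuous_on_Q _ _ x t xt (pdxE i)).
  by apply: cvgM; [exact: cvg_cst|exact: similar_continuous].
split.
  move=> i j; apply: (continuous_on_Q _ _ x t xt (pdxxE i j)).
  apply: cvgM; [exact: cvg_cst|apply: similar_continuous => //].
  exact: cphi2.
apply: (continuous_on_Q _ _ x t xt pdtE); apply: similar_continuous => //.
apply: cvgB; apply: cvgM => //; last exact: cvg_cst.
by apply: cvgM; [exact: cvg_id|exact: cvg_cst].
Qed.

(** Only the last coordinate contributes to the Laplacian and the gradient. All terms carry the same
    power of [- t], so the equation reduces to the profile equation at [Y x t]. *)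
Lemma selfsim_ancient : ancient_solution p u.
Proof.
split; first exact: selfsim_C21.
split.
  apply: continuous_in_subspaceT => -[x t]; rewrite inE => -[/= x0 t0].
  have cs : {for (x, t), continuous (fun z : pt * R => similar gam phi z.1 z.2)}.
    apply: similar_continuous => //.
    by apply: is_derive1_continuous; apply: dphi; exact: Y_ge0.
  suff : u z.1 z.2 @[z --> (x, t)] --> u x t by [].
  rewrite /u selfsimE//; apply: cvg_trans cs; apply: near_eq_cvg; near=> z.
  rewrite selfsimE//; near: z; apply: cvgr_lt t0; exact: cvg_snd.
split.
  move=> x t xt; have [/= x0 t0] := xt; have y0 := Y_ge0 x t (ltW x0).
  have nt : 0 < - t by rewrite oppr_gt0.
  have lap : laplacian u x t = similar (gam - 1) phi2 x t.
    rewrite /laplacian (bigD1 ord_max)//= big1 ?addr0.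
      by rewrite pdxxE// eqxx !mul1r.
    by move=> i /negbTE ne; rewrite pdxxE// ne !mul0r.
  have grad : gradnorm u x t = similar (gam - 2^-1) phi1 x t.
    rewrite /gradnorm (bigD1 ord_max)//= big1 ?addr0.
      rewrite pdxE// eqxx mul1r sqrtr_sqr ger0_norm//.
      by rewrite mulr_ge0 ?powR_ge0// phi1_ge0.
    by move=> i /negbTE ne; rewrite pdxE// ne mul0r expr0n.
  rewrite pdtE// lap grad /similar powRM ?powR_ge0 ?phi1_ge0//.
  rewrite -/(Y x t) profile_eq//.
  (* This identity singles out [gam]: the gradient term then scales like [u_t] and the Laplacian. *)
  rewrite -powRrM; have -> : (gam - 2^-1) * p = gam - 1.
    by rewrite /gam; field; rewrite subr_eq0 gt_eqF.
  by ring.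
move=> x t x0 t0; rewrite /u selfsimE// /similar x0 mul0r phi0 mulr0.
by [].
Unshelve. all: by end_near. Qed.

(** Compare the times [-1] and [- y ^ 2] at height [y]: the similarity variable is [y] at the first
    and 1 at the second. *)
Lemma stationary_selfsim (y : R) : stationary u -> 0 < y ->
  phi y = y `^ (2 * gam) * phi 1.
Proof.
move=> su y0; have y2 : 0 < y `^ 2 by exact: powR_gt0.
have hx : lastc (const_mx y : pt) = y by rewrite /lastc mxE.
have := su (const_mx y) (-1) (- y `^ 2).
rewrite /Qset /= hx !oppr_lt0 => /(_ (conj y0 ltr01) (conj y0 y2)).
rewrite /u !selfsimE ?oppr_lt0// /similar hx !opprK powR1 /= mul1r mulr1 => ->.
rewrite -!powRrM mulrN divff// powRN powRr1 ?(ltW y0)//.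
by rewrite divff// gt_eqF.
Qed.

End Ancient.

End SelfSimilar.

(** * Assembly of the profile, and non-stationarity by growth rates *)

Theorem theorem2p4 (R : realType) (n : nat) (p : R) (hp : 1 < p) :
  let beta := (p - 1)^-1 in
  let gamma := (p - 2) / (2 * (p - 1)) in
  exists (phi phi1 phi2 : R -> R) (L : R),
    (C2_halfline phi phi1 phi2 /\
     phi 0 = 0 /\
     (forall y : R, 0 <= y -> 0 < phi1 y) /\
     0 < L /\
     (fun y : R => phi y / y `^ (beta + 1)) @ +oo --> L) /\
    (let u := @selfsim R n gamma phi in
     ancient_solution p u /\
     (forall x t, Qset (x, t) -> 0 < u x t) /\
     ~ stationary u).
Proof.
move=> beta gamma.
have b0 : 0 < beta by rewrite invr_gt0 subr_gt0.
have pb : p = 1 + beta^-1 by rewrite /beta invrK addrC subrK.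
have gb : gamma = (1 - beta) / 2.
  by rewrite /gamma /beta; field; rewrite subr_eq0 gt_eqF.
have [r [rho [rho0 r0 drho dr rpos]]] := log_slope_exists beta b0.
pose w := wprof beta rho; pose phi := primitive0 w.
pose phi2 y := r y * w y.
pose L := (1 + beta^-1)^-1 `^ beta / (beta + 1).
have w0 (y : R) : 0 < w y by exact: wprof_gt0.
have phi0 : phi 0 = 0 by exact: primitive00.
have dphi (y : R) : 0 <= y -> is_derive y 1 phi (w y).
  by move=> y0; apply: (is_derive_phi beta r).
have dw (y : R) : 0 <= y -> is_derive y 1 w (phi2 y).
  by move=> y0; apply: (is_derive_wprof beta r).
have cphi2 (y : R) : 0 <= y -> {for y, continuous phi2}.
  move=> y0; apply: cvgM; first exact: (is_derive1_continuous (dr y y0)).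
  exact: (is_derive1_continuous (dw y y0)).
have phi_pos (y : R) : 0 < y -> 0 < phi y by move=> y0; apply: (phi_gt0 beta r).
have L0 : 0 < L.
  by rewrite divr_gt0 ?powR_gt0 ?invr_gt0 ?addr_gt0// invr_gt0.
have limL : phi y / y `^ (beta + 1) @[y --> +oo] --> L.
  exact: (phi_asymptotic beta b0 r rho).
have eqn (y : R) : 0 <= y -> phi2 y = y / 2 * w y - gamma * phi y - w y `^ p.
  move=> y0; have := profile_first_order beta r rho rho0 r0 drho dr y y0.
  by rewrite gb pb wprof_powR_p// /phi2 /phi /w; lra.
exists phi, w, phi2, L; split.
  split; last by [].
  split; first by move=> y /ltW; exact: dphi.
  split; first by move=> y /ltW; exact: dw.
  split; first exact: is_derive1_cvg_at_right (dphi 0 _).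
  split; first exact: is_derive1_cvg_at_right (dw 0 _).
  split; [|split]; apply: continuous_in_subspaceT => y;
    rewrite inE /= in_itv /= andbT => y0.
  - exact: (is_derive1_continuous (dphi y y0)).
  - exact: (is_derive1_continuous (dw y y0)).
  - exact: cphi2.
move=> u; split.
  by apply: (selfsim_ancient p phi w phi2) => // y _; exact: ltW.
split.
  move=> x t [/= x0 t0]; rewrite /u selfsimE// /similar mulr_gt0//.
    by rewrite powR_gt0// oppr_gt0.
  by apply: phi_pos; rewrite mulr_gt0// powR_gt0// oppr_gt0.
move=> su.
(* A stationary [u] would make [phi] proportional to [y ^ (2 * gamma)], where
   [2 * gamma = 1 - beta]. This falls short of [beta + 1] by [2 * beta > 0], so the ratio would tend
   to 0 instead of [L]. *)
have : phi y / y `^ (beta + 1) @[y --> +oo] --> phi 1 * 0.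
  have h : phi 1 * (y `^ (2 * beta))^-1 @[y --> +oo] --> phi 1 * 0.
    by apply: cvgMr; apply: cvg_inv_powR; rewrite mulr_gt0.
  apply: cvg_trans h; apply: near_eq_cvg; near=> y.
  have y0 : 0 < y by near: y; apply: nbhs_pinfty_gt; rewrite num_real.
  rewrite (stationary_selfsim p phi y su y0) -/gamma gb [in RHS]mulrAC [RHS]mulrC.
  rewrite -powRB; last by rewrite (gt_eqF y0) implybT.
  by rewrite -powRN; congr (_ * y `^ _); field.
rewrite mulr0 => /(cvg_unique _ limL) L00.
by move: L0; rewrite L00 ?ltxx.
Unshelve. all: by end_near. Qed.
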